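(* Let $G=(A,B,\mathfrak a)$ be a Garland structure. If $\beta_G<\alpha_G$, then the global complex $B$ is exact.
   Context: All Hilbert spaces are real, maps of Hilbert spaces are bounded linear maps, $\mathfrak b^*$ is the adjoint of $\mathfrak b$, and $\mathfrak p_X$ is the orthogonal projection onto a closed subspace $X$. A $3$-term complex $(A,\mathfrak a)$ is a sequence $A^{-1}\xrightarrow{\mathfrak a_0}A^0\xrightarrow{\mathfrak a_1}A^1$ of maps of Hilbert spaces with $\mathfrak a_1\mathfrak a_0=0$. Its homology is $H^0(A)=\frac{\ker(\mathfrak a_1)}{\operatorname{im}(\mathfrak a_0)}\cong\ker(\mathfrak a_0^* )\cap\ker(\mathfrak a_1)$, and the complex is called exact if this homology vanishes. A Garland structure $G=(A,B,\mathfrak a)$ is a pair of $3$-term complexes $(A,\mathfrak a)$ (the local complex) and $(B,\mathfrak b)$ (the global complex) such that $A$ is exact, $B^i\subseteq A^i$ is a (closed) subspace for $i=-1,0,1$, $B^{-1}=A^{-1}$, and $\mathfrak b_i=\mathfrak p_{B^i}\mathfrak a_i$ (on $B^{i-1}$) for $i=0,1$. Set $$\alpha_G=\alpha_A=\inf\{\|\mathfrak a_1(\phi)\|^2:\phi\in\ker(\mathfrak a_0^* ),\ \|\phi\|=1\},\qquad \beta_G=\sup\{\|\mathfrak a_1(\phi)\|^2:\phi\in\ker(\mathfrak b_1),\ \|\phi\|=1\},$$ where the infimum over the empty set is $+\infty$ and the supremum over the empty set is $-\infty$. *)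

(* Defs.v *)
From HB Require Import structures.
From mathcomp Require Import all_boot all_order all_algebra.
From mathcomp Require Import all_classical all_reals all_analysis.
From mathcomp Require Import ring lra.

Set Implicit Arguments.
Unset Strict Implicit.
Unset Printing Implicit Defensive.

Import Order.TTheory GRing.Theory Num.Theory.
Import numFieldNormedType.Exports.

Local Open Scope classical_set_scope.
Local Open Scope ring_scope.

(* With theta = idfun, {dot V for theta} is the library's type of symmetric
   positive definite bilinear forms V -> V -> R. *)
HB.mixin Record CompleteNormedModule_isHilbert (R : realType) V
    & CompleteNormedModule R V := {
  inner : {dot V for idfun};
  inner_norm : forall x : V, inner x x = `|x| ^+ 2
}.

#[short(type="hilbertType")]
HB.structure Definition Hilbert (R : realType) :=
  {V of CompleteNormedModule R V & CompleteNormedModule_isHilbert R V}.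

Arguments inner {R s}.

Section InnerProduct.
Variables (R : realType) (H : hilbertType R).
Implicit Types (x y z : H) (a : R).

Lemma innerC x y : inner x y = inner y x.
Proof. by rewrite hermC expr0 mul1r. Qed.

Lemma inner_norm2B x y a :
  `|x - a *: y| ^+ 2 = `|x| ^+ 2 - 2 * a * inner x y + a ^+ 2 * `|y| ^+ 2.
Proof.
rewrite -!inner_norm linearBl !linearBr !linearZl_LR !linearZr_LR/=.
by rewrite (innerC y x) /GRing.scale/=; ring.
Qed.

Lemma parallelogram x y :
  `|x + y| ^+ 2 + `|x - y| ^+ 2 = 2 * `|x| ^+ 2 + 2 * `|y| ^+ 2.
Proof.
rewrite -!inner_norm linearBl !linearBr !linearDl !linearDr/=.
by rewrite (innerC y x) /GRing.scale/=; ring.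
Qed.

End InnerProduct.

Record closed_subspace (R : realType) (H : hilbertType R) := ClosedSubspace {
  csset : set H;
  csset0 : csset 0;
  cssetP : forall (a : R) x y, csset x -> csset y -> csset (a *: x + y);
  csset_closed : closed csset
}.

Definition subspace_type (R : realType) (H : hilbertType R)
  (S : closed_subspace H) : Type := {x : H | x \in csset S}.

Section SubHilbert.
Variables (R : realType) (H : hilbertType R) (S : closed_subspace H).
Local Notation T := (subspace_type S).

HB.instance Definition _ := [isSub of T for (@sval _ _ : T -> H)].
HB.instance Definition _ := [Choice of T by <:].

Let sub_closed : subsemimod_closed (fun x : H => x \in csset S).
Proof.
split; first split.
- by rewrite unfold_in/= mem_set//; exact: csset0.
- move=> x y /set_mem xS /set_mem yS; apply/mem_set.
  by rewrite -[x]scale1r; exact: cssetP.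
- move=> a x /set_mem xS; apply/mem_set.
  by rewrite -[a *: x]addr0; apply: cssetP => //; exact: csset0.
Qed.

HB.instance Definition _ :=
  GRing.SubChoice_isSubLmodule.Build R H _ T sub_closed.

Lemma sub_valD (x y : T) : val (x + y) = val x + val y.
Proof. exact: raddfD. Qed.

Lemma sub_valB (x y : T) : val (x - y) = val x - val y.
Proof. exact: raddfB. Qed.

Lemma sub_valZ (a : R) (x : T) : val (a *: x) = a *: val x.
Proof. exact: linearZ. Qed.

Let sub_ler_normD (x y : T) : `|val (x + y)| <= `|val x| + `|val y|.
Proof. by rewrite raddfD; exact: ler_normD. Qed.

Let sub_normrZ (a : R) (x : T) : `|val (a *: x)| = `|a| * `|val x|.
Proof. by rewrite linearZ/= normrZ. Qed.

Let sub_normr0_eq0 (x : T) : `|val x| = 0 -> x = 0.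
Proof.
by move=> /normr0_eq0 x0; apply: val_inj; rewrite x0 raddf0.
Qed.

HB.instance Definition _ := @Lmodule_isNormed.Build R T
  (fun x => `|val x|) sub_ler_normD sub_normrZ sub_normr0_eq0.

Lemma sub_normE (x : T) : `|x| = `|val x|.
Proof. by []. Qed.

Lemma val_continuous : continuous (val : T -> H).
Proof.
apply: bounded_linear_continuous; apply/linear_boundedP.
by near=> r => x; rewrite -sub_normE ler_peMl//; near: r; exact: nbhs_pinfty_ge.
Unshelve. all: by end_near. Qed.

Let sub_complete (F : set_system T) : ProperFilter F -> cauchy F -> cvg F.
Proof.
move=> FF /cauchyP Fc.
have /cauchy_cvgP/cvg_ex[/= l Fl] : cauchy (val @ F).
  apply/cauchyP => e /Fc[p Fp]; exists (val p).
  rewrite /= nbhs_filterE /fmap/=; apply: filterS Fp => x.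
  by rewrite /= -!ball_normE /ball_/= sub_normE raddfB.
have Sl : l \in csset S.
  apply/mem_set; apply: (@closed_cvg _ _ F FF _ _ (@csset_closed _ _ S)) Fl.
  by apply: nearW => x; exact/set_mem/valP.
apply/cvg_ex; exists (Sub l Sl : T).
apply/cvgrPdist_lt => e e0.
move/cvgrPdist_lt : Fl => /(_ _ e0); apply: filterS => x.
by rewrite sub_normE raddfB.
Qed.

HB.instance Definition _ := Uniform_isComplete.Build T sub_complete.

Definition sub_inner (x y : T) : R := inner (val x) (val y).

Let sub_inner_bilinear : bilinear_for
  ( *%R : GRing.Scale.law _ _) (idfun \; *%R : GRing.Scale.law _ _) sub_inner.
Proof.
have valD a (x y : T) : val (a *: x + y) = a *: val x + val y.
  exact: linearP.
split=> [u|u] a x y; rewrite /sub_inner valD; first by rewrite linearPl.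
by rewrite linearPr.
Qed.

HB.instance Definition _ := bilinear_isBilinear.Build R T T R
  ( *%R : GRing.Scale.law _ _) (idfun \; *%R : GRing.Scale.law _ _)
  sub_inner sub_inner_bilinear.

Let sub_inner_hermitian (x y : T) :
  sub_inner x y = (-1) ^+ false * idfun (sub_inner y x).
Proof. exact: hermC. Qed.

HB.instance Definition _ := isHermitianSesquilinear.Build R T false idfun
  sub_inner sub_inner_hermitian.

Let sub_inner_gt0 (x : T) : x != 0 -> 0 < sub_inner x x.
Proof.
move=> x0; rewrite /sub_inner inner_norm exprn_gt0// normr_gt0.
by apply: contra x0 => /eqP x0; apply/eqP/val_inj; rewrite x0 raddf0.
Qed.

HB.instance Definition _ := isDotProduct.Build R T sub_inner sub_inner_gt0.

Let sub_inner_norm (x : T) : sub_inner x x = `|x| ^+ 2.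
Proof. exact: inner_norm. Qed.

HB.instance Definition _ :=
  CompleteNormedModule_isHilbert.Build R T sub_inner_norm.

End SubHilbert.

Definition subspace_hilbert (R : realType) (H : hilbertType R)
  (S : closed_subspace H) : hilbertType R := subspace_type S.
Coercion subspace_hilbert : closed_subspace >-> hilbertType.

Lemma innerE (R : realType) (H : hilbertType R) (S : closed_subspace H)
  (x y : S) : inner x y = inner (val x) (val y).
Proof. by []. Qed.

Section Projection.
Variables (R : realType) (H : hilbertType R) (S : closed_subspace H).

Lemma ex_nearest (x : H) :
  exists y : S, forall z : S, `|x - val y| ^+ 2 <= `|x - val z| ^+ 2.
Proof.
pose D := [set `|x - val z| ^+ 2 | z in [set: S]].
have D_inf : has_inf D.
  split; first by exists (`|x - val (0 : S)| ^+ 2); exists 0.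
  by exists 0 => _ [z _ <-]; exact: exprn_ge0.
pose d := inf D.
have dle z : d <= `|x - val (z : S)| ^+ 2.
  by apply: ge_inf; [exact: D_inf.2|exists z].
pose A (e : R) := [set z : S | `|x - val z| ^+ 2 < d + e].
pose F := filter_from [set e : R | 0 < e] A.
have FF : ProperFilter F.
  apply: filter_from_proper; last first.
    move=> e e0; have [_ [z _ <-] zd] := inf_adherent e0 D_inf.
    by exists z.
  apply: filter_from_filter; first by exists 1 => /=.
  move=> e f e0 f0; exists (Num.min e f); first by rewrite /= lt_min e0.
  move=> z; rewrite /A/= => zd; split; apply: (lt_le_trans zd).
    by rewrite lerD2l ge_min lexx.
  by rewrite lerD2l ge_min lexx orbT.
have /cauchy_cvgP/cvg_ex[/= l Fl] : cauchy F.
  apply/cauchyP => e e0; have e4 : 0 < e ^+ 2 / 4.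
    by rewrite divr_gt0// exprn_gt0.
  have [_ [p _ <-] pd] := inf_adherent e4 D_inf.
  exists p; exists (e ^+ 2 / 4) => // z zd.
  rewrite -ball_normE /ball_/= -(@ltr_pXn2r _ 2)// ?nnegrE// 1?ltW//.
  rewrite distrC sub_normE.
  have := dle ((1 / 2) *: (p + z)).
  have := parallelogram (x - val p) (x - val z).
  have -> : x - val p - (x - val z) = val (z - p).
    by rewrite sub_valB opprB addrC addrA subrK.
  have -> : x - val p + (x - val z) = 2 *: (x - val ((1 / 2) *: (p + z))).
    rewrite sub_valZ sub_valD scalerBr scalerA.
    rewrite (_ : 2 * (1 / 2) = 1) ?scale1r; last by field.
    by rewrite scaler_nat mulr2n opprD addrACA.
  rewrite normrZ normr_nat exprMn => h1 h2.
  move: pd zd; rewrite /A/= -/d => pd zd.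
  by lra.
exists l => z; apply: le_trans (dle z).
apply/ler_addgt0Pr => e e0.
have h : (fun z : S => `|x - val z| ^+ 2) @ F --> `|x - val l| ^+ 2.
  have vl : (fun z : S => val z) @ F --> val l.
    exact: cvg_comp Fl (@val_continuous _ _ S l).
  apply: cvgM; apply: cvg_norm; apply: cvgB => //; exact: cvg_cst.
have := (fun X => closed_cvg _ (@closed_le R (d + e)) X _ h).
by apply; exists e => // y /ltW.
Qed.

Lemma ex_proj (x : H) :
  exists y : S, forall z : S, inner (x - val y) (val z) = 0.
Proof.
have [y ymin] := ex_nearest x; exists y => z.
set u := x - val y.
have key t : 0 <= t ^+ 2 * `|z| ^+ 2 - 2 * t * inner u (val z).
  have := ymin (y + t *: z).
  have -> : x - val (y + t *: z) = u - t *: val z.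
    by rewrite sub_valD sub_valZ opprD addrA.
  by rewrite inner_norm2B -sub_normE; lra.
move: key; set c := inner u (val z); set n := `|z| ^+ 2 => key.
have n0 : 0 <= n by exact: exprn_ge0.
have [z0|z0] := eqVneq n 0.
  by have := key c; rewrite z0; nra.
have zp : 0 < n by rewrite lt_def z0.
have := key (c / n).
have -> : (c / n) ^+ 2 * n - 2 * (c / n) * c = - (c ^+ 2 / n) by field.
rewrite oppr_ge0 pmulr_lle0 ?invr_gt0// => c0.
by apply/eqP; rewrite -(sqrf_eq0 c) eq_le c0 sqr_ge0.
Qed.

(* The default value 0 is never used, by ex_proj. *)
Definition proj (x : H) : S :=
  xget 0 [set y : S | forall z : S, inner (x - val y) (val z) = 0].

Lemma projP (x : H) (z : S) : inner (x - val (proj x)) (val z) = 0.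
Proof.
rewrite /proj; case: xgetP => [y _ /=|nex]; first exact.
by have [y yP] := ex_proj x; case: (nex y).
Qed.

End Projection.

Section Adjoint.
Variables (R : realType) (U V : hilbertType R).

Lemma riesz (f : {linear U -> R^o}) : continuous f ->
  exists y : U, forall x, f x = inner x y.
Proof.
move=> fc.
have K0 : [set x | f x = 0] 0 by exact: linear0.
have KP a x y : [set x | f x = 0] x -> [set x | f x = 0] y ->
    [set x | f x = 0] (a *: x + y).
  by move=> /= fx fy; rewrite linearP fx fy scaler0 addr0.
have Kc : closed [set x | f x = 0].
  rewrite (_ : [set _ | _] = f @^-1` [set 0])//.
  by apply: preimage_closed => [x _|]; [exact: fc|exact: closed_eq].
pose K := ClosedSubspace K0 KP Kc.
have [f0|] := pselect (forall x, f x = 0).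
  by exists 0 => x; rewrite f0 linear0r.
move=> /existsNP[x fx0].
pose u := x - val (proj K x).
have fu : f u = f x.
  by rewrite linearB/= (set_mem (valP (proj K x))) subr0.
have u0 : u != 0.
  by apply: contra_notN fx0 => /eqP u0; rewrite -fu u0 linear0.
have uu : `|u| ^+ 2 != 0 by rewrite sqrf_eq0 normr_eq0.
exists ((f u / `|u| ^+ 2) *: u) => z.
have wK : f (f z *: u - f u *: z) = 0.
  rewrite linearB/= !linearZ/= /GRing.scale/=.
  by rewrite [f z * _]mulrC -mulrDr subrr mulr0.
have : inner u (f z *: u - f u *: z) = 0.
  pose w : subspace_type K := exist (fun v => v \in csset K) _ (@mem_set _ (csset K) _ wK).
  exact: (projP x w).
rewrite linearBr !linearZr_LR/= inner_norm.
rewrite (innerC u z) => /eqP; rewrite subr_eq0 => /eqP e.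
by apply: (mulIf uu); rewrite mulrAC divfK.
Qed.

Lemma ex_adjoint (f : {linear U -> V}) : continuous f ->
  forall y, exists z, forall x, inner (f x) y = inner x z.
Proof.
move=> fc y; pose g (x : U) : R^o := inner (f x) y.
have glin : linear g.
  by move=> a x x'; rewrite /g linearP linearPl.
pose gL : {linear U -> R^o} := HB.pack g (GRing.isLinear.Build _ _ _ _ g glin).
apply: (@riesz gL).
have gE x : gL x = (`|f x + y| ^+ 2 - `|f x - y| ^+ 2) / 4.
  have h1 := inner_norm2B (f x) y 1; have h2 := inner_norm2B (f x) y (- 1).
  by move: h1 h2; rewrite scaleN1r scale1r opprK /= /g => -> ->; field.
rewrite (funext gE) => x.
apply: cvgM; last exact: cvg_cst.
have fx : f z @[z --> x] --> f x by exact: fc.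
apply: cvgB; apply: cvgM; apply: cvg_norm.
- by apply: cvgD => //; exact: cvg_cst.
- by apply: cvgD => //; exact: cvg_cst.
- by apply: cvgB => //; exact: cvg_cst.
- by apply: cvgB => //; exact: cvg_cst.
Qed.

(* For continuous linear f the default value 0 is never used, by ex_adjoint. *)
Definition adjoint (f : U -> V) (y : V) : U :=
  xget 0 [set z | forall x, inner (f x) y = inner x z].

Lemma adjointP (f : {linear U -> V}) : continuous f ->
  forall x y, inner (f x) y = inner x (adjoint f y).
Proof.
move=> fc x y; rewrite /adjoint; case: xgetP => [z _ /=|nex]; first exact.
by have [z zP] := ex_adjoint fc y; case: (nex z).
Qed.

End Adjoint.

(* For linear maps of normed spaces, continuous means bounded
   (linear_bounded_continuous). *)
Record complex3 (R : realType) (X Y Z : hilbertType R) := Complex3 {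
  d0 : {linear X -> Y};
  d1 : {linear Y -> Z};
  d0_continuous : continuous d0;
  d1_continuous : continuous d1;
  d1_d0 : forall x, d1 (d0 x) = 0
}.

(* The algebraic quotient ker d1 / im d0 vanishes; im d0 is not replaced by
   its closure. *)
Definition is_exact (R : realType) (X Y Z : hilbertType R)
  (C : complex3 X Y Z) : Prop := [set y | d1 C y = 0] = range (d0 C).

Record garland (R : realType) := Garland {
  Aminus : hilbertType R;
  Azero : hilbertType R;
  Aplus : hilbertType R;
  local_complex : complex3 Aminus Azero Aplus;
  Bminus : closed_subspace Aminus;
  Bzero : closed_subspace Azero;
  Bplus : closed_subspace Aplus;
  global_complex : complex3 Bminus Bzero Bplus;
  local_exact : is_exact local_complex;
  Bminus_full : csset Bminus = setT;
  global_d0 : forall x : Bminus,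
    d0 global_complex x = proj Bzero (d0 local_complex (val x));
  global_d1 : forall x : Bzero,
    d1 global_complex x = proj Bplus (d1 local_complex (val x))
}.

(* ereal_inf set0 = +oo and ereal_sup set0 = -oo. *)
Definition alpha (R : realType) (G : garland R) : \bar R :=
  let A := local_complex G in
  ereal_inf [set (`|d1 A x| ^+ 2)%:E |
    x in [set x : Azero G | adjoint (d0 A) x = 0 /\ `|x| = 1]].

Definition beta (R : realType) (G : garland R) : \bar R :=
  ereal_sup [set (`|d1 (local_complex G) (val x)| ^+ 2)%:E |
    x in [set x : Bzero G | d1 (global_complex G) x = 0 /\ `|x| = 1]].

(* Main.v *)
Require Import Defs.
From mathcomp Require Import all_boot all_order all_algebra.
From mathcomp Require Import all_classical all_reals all_analysis.
From mathcomp Require Import lra.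

Set Implicit Arguments.
Unset Strict Implicit.
Unset Printing Implicit Defensive.

Import Order.TTheory GRing.Theory Num.Theory.
Import numFieldNormedType.Exports.

(** Write [L = ker a_1 = im a_0] (the local complex is exact) and
    [K = ker b_1]; every [y] in [L] is some [a_0 x], and since [B^-1 = A^-1]
    its projection to [B^0] is [b_0 x].  So it suffices to show that each
    element of [K] is the projection to [B^0] of an element of [L]: then [K] is
    the range of [b_0] itself, with no closure to take.

    For [eta] in [K], let [chi = eta - p_L eta].  Then [chi] is orthogonal to
    [im a_0], that is [a_0^* chi = 0], and [a_1 chi = a_1 eta].  With reals
    [beta_G <= b < a <= alpha_G] this gives
      [a |chi|^2 <= |a_1 chi|^2 = |a_1 eta|^2 <= b |eta|^2]
    ([ker_defect_le]).  The map [T eta = p_(B^0) (p_L eta)] sends [K] to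
    [b_0 (B^-1)], hence to [K], and [eta - T eta = p_(B^0) chi] has norm at
    most [sqrt (b / a) |eta|].  A linear self-map of a complete space at
    distance less than 1 from the identity is onto, by the contraction
    principle ([near_id_surjective]); so every element of [K] is some [T eta],
    and [T eta] lies in the range of [b_0] ([exact_of_bounds]).

    Such [a] and [b] exist as soon as [K] has a nonzero element, which forces
    [0 <= beta_G < +oo] ([bounds_between]); if [K = 0] exactness is clear. *)

Section Proof.
Local Open Scope classical_set_scope.
Local Open Scope ring_scope.
Local Notation proj := Defs.proj.

(** Solving [T x = y] means finding a fixed point of [x |-> x - (T x - y)], and
    this map is a [q]-contraction of [U]: two of its values differ by
    [(x - z) - T (x - z)]. *)
Lemma near_id_surjective (R : realType) (V : completeNormedModType R)
    (U : set V) (T : V -> V) (q : R) :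
  closed U -> (forall x y, U x -> U y -> U (x - y)) ->
  (forall x y, T (x - y) = T x - T y) -> (forall x, U x -> U (T x)) ->
  0 <= q < 1 -> (forall x, U x -> `|x - T x| <= q * `|x|) ->
  forall y, U y -> exists2 x, U x & T x = y.
Proof.
move=> Ucl UB TB UT /andP[q0 q1] Tq y Uy.
pose f x := x - (T x - y).
have fU : {homo f : x / U x >-> U x}.
  by move=> x Ux; apply: (UB) => //; apply: UB => //; exact: UT.
pose F : {fun U >-> U} := mkfun fU.
have Fctr : is_contraction F.
  exists (NngNum q0); split => //= -[x z] /= [Ux Uz].
  have -> : f x - f z = (x - z) - T (x - z).
    have e : (T x - y) - (T z - y) = T (x - z) by rewrite TB opprB addrA subrK.
    by rewrite -e /f (opprD z) addrACA -opprD.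
  by apply: Tq; exact: UB.
have [x Ux /esym/eqP] := banach_fixed_point Fctr Ucl (ex_intro _ y Uy).
rewrite /= /f subr_eq addrC -subr_eq subrr eq_sym subr_eq0 => /eqP Txy.
by exists x.
Qed.

Section Inner.
Variable R : realType.

Lemma innerBl (K : hilbertType R) (x y z : K) :
  inner (x - y) z = inner x z - inner y z.
Proof. exact: linearBl. Qed.

Lemma inner_eq0 (K : hilbertType R) (x : K) : inner x x = 0 -> x = 0.
Proof.
by rewrite inner_norm => /eqP; rewrite sqrf_eq0 normr_eq0 => /eqP.
Qed.

End Inner.

Section Projection.
Variables (R : realType) (H : hilbertType R) (S : closed_subspace H).

(** Orthogonality to [S] of the remainder characterizes the projection; the
    algebraic properties of [proj] follow from this. *)
Lemma proj_unique (x : H) (y : S) :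
  (forall z : S, inner (x - val y) (val z) = 0) -> proj S x = y.
Proof.
move=> yP; apply/eqP; rewrite -subr_eq0; set z := proj S x - y.
have e : val z = (x - val y) - (x - val (proj S x)).
  by rewrite sub_valB opprB [RHS]addrC addrA subrK.
apply/eqP/inner_eq0; move: z e => z e.
by rewrite innerE {1}e innerBl (yP z) (projP x z) subrr.
Qed.

Lemma proj_val (y : S) : proj S (val y) = y.
Proof. by apply: proj_unique => z; rewrite subrr linear0l. Qed.

Lemma projB (x y : H) : proj S (x - y) = proj S x - proj S y.
Proof.
apply: proj_unique => z.
have -> : x - y - val (proj S x - proj S y) =
    (x - val (proj S x)) - (y - val (proj S y)).
  by rewrite sub_valB !opprD addrACA.
by rewrite innerBl !projP subrr.
Qed.

Lemma proj_pythagoras (x : H) :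
  `|x| ^+ 2 = `|proj S x| ^+ 2 + `|x - val (proj S x)| ^+ 2.
Proof.
have /esym := inner_norm2B x (val (proj S x)) 1.
have := projP x (proj S x); rewrite innerBl scale1r inner_norm sub_normE.
by lra.
Qed.

Lemma norm_proj_le (x : H) : `|proj S x| <= `|x|.
Proof.
rewrite -(@ler_pXn2r _ 2)// ?nnegrE//.
by rewrite [leRHS]proj_pythagoras lerDl exprn_ge0.
Qed.

End Projection.

Section Kernel.
Variables (R : realType) (H K : hilbertType R) (f : {linear H -> K}).
Hypothesis fc : continuous f.

Lemma closed_ker : closed [set x | f x = 0].
Proof.
rewrite (_ : [set _ | _] = f @^-1` [set 0])//.
apply: preimage_closed => [x _|]; first exact: fc.
apply: accessible_closed_set1; apply: hausdorff_accessible.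
exact: norm_hausdorff.
Qed.

Let ker0 : [set x | f x = 0] 0. Proof. exact: linear0. Qed.

Let kerP (a : R) x y :
  [set x | f x = 0] x -> [set x | f x = 0] y -> [set x | f x = 0] (a *: x + y).
Proof. by move=> /= fx fy; rewrite linearP fx fy scaler0 addr0. Qed.

Definition ker : closed_subspace H := ClosedSubspace ker0 kerP closed_ker.

End Kernel.

Section Garland.
Variables (R : realType).

Lemma adjoint_eq0 (U V : hilbertType R) (f : {linear U -> V}) (y : V) :
  continuous f -> adjoint f y = 0 <-> forall x, inner (f x) y = 0.
Proof.
move=> fc; split=> [y0 x|y0]; first by rewrite adjointP// y0 linear0r.
by apply: inner_eq0; rewrite -adjointP.
Qed.

Lemma norm_normalize (V : normedModType R) (x : V) :
  x != 0 -> `| `|x|^-1 *: x | = 1.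
Proof.
by move=> x0; rewrite normrZ normfV normr_id mulVf// normr_eq0.
Qed.

Lemma sqnorm_normalize (U V : normedModType R) (f : {linear U -> V}) (x : U) :
  x != 0 -> `|f (`|x|^-1 *: x)| ^+ 2 * `|x| ^+ 2 = `|f x| ^+ 2.
Proof.
move=> x0; rewrite linearZ/= normrZ normfV normr_id -exprMn mulrAC.
by rewrite mulVf ?mul1r// normr_eq0.
Qed.

Variable G : garland R.
Let A := local_complex G.
Let B := global_complex G.

(** The infimum defining [alpha] runs over unit vectors; by homogeneity it
    bounds [|a_1 x|^2] on all of [ker a_0^*]. *)
Lemma alpha_lower_bound (a : R) (x : Azero G) : (a%:E <= alpha G)%E ->
  adjoint (d0 A) x = 0 -> a * `|x| ^+ 2 <= `|d1 A x| ^+ 2.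
Proof.
move=> aG x0; have [->|xn0] := eqVneq x 0.
  by rewrite normr0 expr0n mulr0 exprn_ge0.
rewrite -sqnorm_normalize// ler_wpM2r ?exprn_ge0// -lee_fin.
apply: (le_trans aG); apply: ereal_inf_lbound.
exists (`|x|^-1 *: x) => //; split; last exact: norm_normalize.
move/(adjoint_eq0 _ (@d0_continuous _ _ _ _ A)) : x0 => x0.
apply/(adjoint_eq0 _ (@d0_continuous _ _ _ _ A)) => y.
by rewrite linearZr_LR/= x0 mulr0.
Qed.

Lemma le_beta (x : Bzero G) : d1 B x = 0 -> x != 0 ->
  ((`|d1 A (val (`|x|^-1 *: x))| ^+ 2)%:E <= beta G)%E.
Proof.
move=> x0 xn0; apply: ereal_sup_ubound; exists (`|x|^-1 *: x) => //.
by split; [rewrite linearZ/= x0 scaler0|exact: norm_normalize].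
Qed.

Lemma beta_upper_bound (b : R) (x : Bzero G) : (beta G <= b%:E)%E ->
  d1 B x = 0 -> `|d1 A (val x)| ^+ 2 <= b * `|x| ^+ 2.
Proof.
move=> bG x0; have [->|xn0] := eqVneq x 0.
  have -> : val (0 : Bzero G) = 0.
    by have := sub_valB (0 : Bzero G) 0; rewrite !subrr.
  by rewrite linear0 !normr0 expr0n mulr0.
have vx0 : val x != 0 by rewrite -normr_eq0 -sub_normE normr_eq0.
rewrite -(sqnorm_normalize (d1 A) vx0) -sub_normE -sub_valZ.
rewrite ler_wpM2r ?exprn_ge0// -lee_fin.
exact: le_trans (le_beta x0 xn0) bG.
Qed.

Let L := ker (@d1_continuous _ _ _ _ A).

(** The remainder [x - p_L x] is orthogonal to [im a_0] and has the same image
    under [a_1] as [x], so the lower bound [a] applies to it and the upper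
    bound [b] applies to [x]. *)
Lemma ker_defect_le (a b : R) (x : Bzero G) :
  0 < a -> 0 <= b -> (a%:E <= alpha G)%E -> (beta G <= b%:E)%E -> d1 B x = 0 ->
  `|val x - val (proj L (val x))| <= Num.sqrt (b / a) * `|x|.
Proof.
move=> a0 b0 aG bG x0; set y := _ - _.
have Ay : d1 A y = d1 A (val x).
  by rewrite linearB/= (set_mem (valP (proj L (val x)))) subr0.
have y0 : adjoint (d0 A) y = 0.
  apply/(adjoint_eq0 _ (@d0_continuous _ _ _ _ A)) => z.
  have Lz : d0 A z \in csset L by apply/mem_set; exact: d1_d0.
  rewrite innerC; exact: (projP (val x) (exist _ (d0 A z) Lz : L)).
have := alpha_lower_bound aG y0; rewrite Ay => /le_trans/(_ (beta_upper_bound bG x0)).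
rewrite mulrC -ler_pdivlMr// mulrAC => yx.
rewrite -(@ler_pXn2r _ 2)// ?nnegrE ?mulr_ge0 ?sqrtr_ge0//.
by rewrite exprMn sqr_sqrtr// divr_ge0// ltW.
Qed.

(** Exactness of the local complex writes [y] as [a_0 x], and [B^-1 = A^-1]
    lets [b_0] be applied to this same [x]. *)
Lemma proj_ker_range (y : Azero G) :
  d1 A y = 0 -> range (d0 B) (proj (Bzero G) y).
Proof.
move=> Ay; have : [set y | d1 A y = 0] y by [].
rewrite (local_exact G) => -[x _ <-].
have Bx : x \in csset (Bminus G) by rewrite Bminus_full inE.
by exists (exist _ x Bx : Bminus G) => //; rewrite global_d0.
Qed.

(** On [ker b_1], projecting to [L] and back to [B^0] is within
    [sqrt (b / a) < 1] of the identity, hence onto, while its values lie in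
    the range of [b_0]. *)
Lemma exact_of_bounds (a b : R) :
  0 <= b < a -> (a%:E <= alpha G)%E -> (beta G <= b%:E)%E -> is_exact B.
Proof.
move=> /andP[b0 ba] aG bG; have a0 : 0 < a by exact: le_lt_trans ba.
apply/seteqP; split=> [y y0|_ [x _ <-]]; last exact: d1_d0.
pose T (x : Bzero G) := proj (Bzero G) (val (proj L (val x))).
have TP x : range (d0 B) (T x).
  by apply: proj_ker_range; exact: set_mem (valP (proj L (val x))).
have [||||||x _ <-] := @near_id_surjective R (Bzero G) [set x | d1 B x = 0] T
    (Num.sqrt (b / a)) _ _ _ _ _ _ y y0; last exact: TP.
- exact: closed_ker (@d1_continuous _ _ _ _ B).
- by move=> x z /= x0 z0; rewrite linearB/= x0 z0 subrr.
- by move=> x z; rewrite /T sub_valB !(projB, sub_valB).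
- by move=> x _; have [z _ <-] := TP x; exact: d1_d0.
- rewrite sqrtr_ge0 -[ltRHS]sqrtr1 ltr_sqrt ?ltr01//.
  by rewrite ltr_pdivrMr ?mul1r.
- move=> x x0; apply: le_trans (ker_defect_le a0 b0 aG bG x0).
  by rewrite -[X in X - T x](proj_val x) -projB; exact: norm_proj_le.
Qed.

(** A nonzero [x] in [ker b_1] makes [beta G] nonnegative, so [b = beta G] is a
    real number.  Without such an [x], [beta G = -oo] and [alpha G] might be
    [0], leaving no room for [0 <= b < a]. *)
Lemma bounds_between (x : Bzero G) :
  (beta G < alpha G)%E -> d1 B x = 0 -> x != 0 ->
  exists a b, [/\ 0 <= b < a, (a%:E <= alpha G)%E & (beta G <= b%:E)%E].
Proof.
move=> ba x0 xn0.
have b0 : (0 <= beta G)%E.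
  by apply: le_trans (le_beta x0 xn0); rewrite lee_fin exprn_ge0.
case: (beta G) (alpha G) b0 ba => [b| |] [a| |]//.
  all: rewrite ?lee_fin ?lte_fin => b0 ba.
- by exists a, b; rewrite b0 ba !lexx.
(* Here [alpha G = +oo], and any real above [b] will do for [a]. *)
- by exists (b + 1), b; rewrite b0 ltrDl ltr01 leey lexx.
Qed.

End Garland.

End Proof.

Local Open Scope ereal_scope.

Theorem theorem2p2 (R : realType) (G : garland R) :
  beta G < alpha G -> is_exact (global_complex G).
Proof.
move=> ba; have [[x [x0 xn0]]|nex] := pselect (exists x : Bzero G,
    d1 (global_complex G) x = 0%R /\ x != 0%R).
  have [a [b [ab aG bG]]] := bounds_between ba x0 xn0.
  exact: exact_of_bounds ab aG bG.
apply/seteqP; split=> [x x0|_ [x _ <-]]; last exact: d1_d0.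
exists 0%R => //; rewrite linear0; apply/esym/eqP.
by apply: contra_notT nex => xn0; exists x.
Qed.
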